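(* Let $p>1$ and $A_{\min},c_+,c_->0$. Assume that the density $f_*$ satisfies $$J:=\int_{\mathcal{Z}}f_*^p\left((\ln f_* )^2\vee1\right)d\mu<+\infty\qquad\text{and}\qquad 0<A_{\min}\le\inf_{z\in\mathcal{Z}}f_*(z).$$ Then there exists a positive constant $A_{MR,-}$ depending only on $A_{\min},J,r$ and $p$ such that, for any $m\in\mathcal{M}_n$, $$P\left[\left(\frac{f_m}{f_*}\vee1\right)\left(\ln\left(\frac{f_m}{f_*}\right)\right)^2\right]\le A_{MR,-}\times\mathcal{K}(f_*,f_m)^{1-1/p}$$ and, for any $0<r\le p-1$, $$P\left[\left(\frac{f_*}{f_m}\vee1\right)^r\left(\ln\left(\frac{f_m}{f_*}\right)\right)^2\right]\le A_{MR,-}\times\mathcal{K}(f_*,f_m)^{1-\frac{r+1}{p}}.$$ If moreover $\ln(f_* )\in L_\infty(\mu)$, i.e. $0<A_{\min}\le\inf_{z\in\mathcal{Z}}f_*(z)\le\|f_*\|_\infty<+\infty$, then there exists $\tilde A>0$ depending only on $r,A_{\min}$ and $\|f_*\|_\infty$ such that, for any $m\in\mathcal{M}_n$, $$P\left[\left(\frac{f_m}{f_*}\vee1\right)\left(\ln\left(\frac{f_m}{f_*}\right)\right)^2\right]\vee P\left[\left(\frac{f_*}{f_m}\vee1\right)^r\left(\ln\left(\frac{f_m}{f_*}\right)\right)^2\right]\le\tilde A\times\mathcal{K}(f_*,f_m).$$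
   Context: $(\mathcal{Z},\mathcal{T})$ is a measurable space, $\mu$ a probability measure on it, and $P$ is a probability measure on $(\mathcal{Z},\mathcal{T})$ with density $f_*=dP/d\mu$, where $\ln f_*\in L_1(P)$. $P[g]=\int g\,dP$ and $a\vee b=\max(a,b)$. For densities $f,g$ with respect to $\mu$, the Kullback-Leibler divergence is $\mathcal{K}(f,g)=\int f\ln(f/g)\,d\mu$ if $f\,d\mu\ll g\,d\mu$, and $+\infty$ otherwise (convention $0\ln0=0$). $\mathcal{M}_n$ is a finite collection of histogram models: each $m\in\mathcal{M}_n$ is associated with a finite partition $\Lambda_m$ of $\mathcal{Z}$ into measurable sets $I$ with $\mu(I)>0$, $m=\{f=\sum_{I\in\Lambda_m}\beta_I\mathbf{1}_I;\ \beta_I\ge0,\ \sum_I\beta_I\mu(I)=1\}$, and $f_m=\sum_{I\in\Lambda_m}\frac{P(I)}{\mu(I)}\mathbf{1}_I$ is the Kullback-Leibler projection of $f_*$ onto $m$. The constants $A_{MR,-}$ and $\tilde A$ may depend on $r$, where $0<r\le p-1$ throughout; they do not depend on $m$. *)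

(* Defs.v *)
From HB Require Import structures.
From mathcomp Require Import all_boot all_order all_algebra.
From mathcomp Require Import all_classical all_reals all_analysis.

Set Implicit Arguments.
Unset Strict Implicit.
Unset Printing Implicit Defensive.

Import Order.TTheory GRing.Theory Num.Theory.
Import numFieldNormedType.Exports.

Local Open Scope classical_set_scope.
Local Open Scope ring_scope.

Section Defs.
Context {d : measure_display} {Z : measurableType d} {R : realType}.
Implicit Types (mu P : probability Z R) (f g : Z -> R).

Definition is_density mu P f : Prop :=
  [/\ measurable_fun setT f, (forall z, 0 <= f z) &
      forall A, measurable A -> P A = (\int[mu]_(z in A) (f z)%:E)%E].

(* The convention 0 ln 0 = 0 is automatic, because of the product by f z = 0.
   When f dmu << g dmu, the points where g vanishes but f does not, at which
   the quotient has a junk value, form a mu-null set. *)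
Definition KL mu f g : \bar R :=
  if `[< (fun A => \int[mu]_(z in A) (f z)%:E)%E `<<
         (fun A => \int[mu]_(z in A) (g z)%:E)%E >]
  then (\int[mu]_z (f z * ln (f z / g z))%:E)%E
  else +oo%E.

Definition histogram_partition mu (Lambda : set (set Z)) : Prop :=
  [/\ finite_set Lambda, classical_sets.partition Lambda id setT &
      forall I, Lambda I -> measurable I /\ (0 < mu I)%E].

Definition histogram_model mu (Lambda : set (set Z)) : set (Z -> R) :=
  [set f | exists beta : set Z -> R,
    [/\ forall I, Lambda I -> 0 <= beta I,
        \sum_(I \in Lambda) beta I * fine (mu I) = 1 &
        f = fun z => \sum_(I \in Lambda) beta I * \1_I z]].

(* A model is a set of densities; Lambda associates a partition to it. *)
Definition histogram_collection mu (M : set (set (Z -> R)))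
    (Lambda : set (Z -> R) -> set (set Z)) : Prop :=
  finite_set M /\
  forall m, M m -> histogram_partition mu (Lambda m) /\
                   m = histogram_model mu (Lambda m).

Definition histogram_proj mu P (Lambda : set (set Z)) : Z -> R :=
  fun z => \sum_(I \in Lambda) fine (P I) / fine (mu I) * \1_I z.

End Defs.

(* Main.v *)
Require Import Defs.
From HB Require Import structures.
From mathcomp Require Import all_boot all_order all_algebra.
From mathcomp Require Import all_classical all_reals all_analysis.
From mathcomp Require Import ess_sup_inf measurable_realfun ring lra.

Set Implicit Arguments.
Unset Strict Implicit.
Unset Printing Implicit Defensive.

Import Order.TTheory GRing.Theory Num.Theory.
Import numFieldNormedType.Exports.

Local Open Scope classical_set_scope.
Local Open Scope ring_scope.

(** Write y = f_m / f and gap y = y - 1 - ln y, a nonnegative convex function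
    vanishing to second order at y = 1. Since f and f_m have the same mass, the
    linear part of the gap integrates to zero, so KL(f, f_m) = P[gap y]
    ([KL_eq_integral_gap]), and the theorem compares weighted versions of
    (ln y)^2 with the gap.

    The comparison rests on one elementary bound, gap y >= (sqrt y - 1)^2
    ([sqr_sub1_le_gap_sqr], stated with y = x^2), which with ln x <= x - 1
    gives (ln y)^2 <= 4 gap y for y >= 1 and (ln y)^2 <= 4 gap y / y for
    y <= 1. When f lies between A and B almost everywhere, y and 1/y are at
    most max (B/A, 1), and the linear bound follows at once.

    When f is only bounded below, y and 1/y are unbounded and the weights have
    to be paid for. Each weighted squared logarithm is bounded pointwise by
    C * (gap y)^(1-s) * W^s, with s = 1/p in one case and s = (r+1)/p in the
    other, where W = y^p + v^(p-1) (ln v)^2 and v = max (1/y, 1)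
    ([max_ln_sqr_le], [max_powR_ln_sqr_le]). Hoelder's inequality under P then
    yields C * KL^(1-s) * P[W]^s ([integral_le_powR_KL]).

    There remains P[W] <= const * J ([integral_envelope_le]). Because f >= A,
    also f_m >= A, and f W <= A^(1-p) (f_m^p + const * f^p max ((ln f)^2, 1)).
    The integral of f_m^p is at most that of f^p by Jensen's inequality on each
    cell ([integral_powR_histogram_proj_le]). The factor (ln v)^2 of W matters
    in the extreme case r = p - 1, where s = 1 and W must dominate
    v^(p-1) (ln v)^2 itself. *)

(** * The gap function and squared logarithms *)

Section RealInequalities.
Context {R : realType}.
Implicit Types (y p r s K : R).

(** The Bregman divergence of y |-> - ln y between y and 1. *)
Definition gap y : R := y - 1 - ln y.

Lemma ln_le_sub1 y : 0 < y -> ln y <= y - 1.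
Proof.
move=> y0; have := @le_ln1Dx R (y - 1).
by rewrite [X in ln X]addrC subrK; apply; lra.
Qed.

Lemma gap_ge0 y : 0 < y -> 0 <= gap y.
Proof. by move=> y0; rewrite subr_ge0 ln_le_sub1. Qed.

Lemma ln_sqr y : 0 < y -> ln (y ^+ 2) = 2 * ln y.
Proof. by move=> y0; rewrite lnXn// mulr_natl. Qed.

(** The Hellinger lower bound for the Kullback-Leibler divergence, in pointwise
    form: after expansion it is just ln y <= y - 1. *)
Lemma sqr_sub1_le_gap_sqr y : 0 < y -> (y - 1) ^+ 2 <= gap (y ^+ 2).
Proof.
move=> y0; rewrite /gap ln_sqr//.
have := ln_le_sub1 y0; lra.
Qed.

Lemma pos_eq_sqr y : 0 < y -> exists2 x : R, 0 < x & y = x ^+ 2.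
Proof.
by move=> y0; exists (Num.sqrt y); [rewrite sqrtr_gt0|rewrite sqr_sqrtr // ltW].
Qed.

Lemma ln_sqr_le_gap_ge1 y : 1 <= y -> ln y ^+ 2 <= 4 * gap y.
Proof.
move=> y1; have [|x x0 yE] := @pos_eq_sqr y; first lra.
have x1 : 1 <= x by move: y1; rewrite yE; nra.
have h := sqr_sub1_le_gap_sqr x0.
have l0 := ln_ge0 x1; have l1 := ln_le_sub1 x0.
by rewrite yE ln_sqr//; nra.
Qed.

(** For small y the gap grows only like - ln y, so (ln y)^2 needs a factor that
    is unbounded as y tends to 0; 1/y keeps the constants explicit. *)
Lemma ln_sqr_le_gap_le1 y : 0 < y -> y <= 1 -> ln y ^+ 2 <= 4 * (y^-1 * gap y).
Proof.
move=> y0 y1; have [x x0 yE] := pos_eq_sqr y0.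
have x1 : x <= 1 by move: y1; rewrite yE; nra.
have h := sqr_sub1_le_gap_sqr x0.
have l0 := ln_le0 x1.
have l1 : - ln x <= x^-1 - 1 by rewrite -lnV ?posrE// ln_le_sub1 ?invr_gt0.
have : ln y ^+ 2 <= 4 * (x^-1 - 1) ^+ 2 by rewrite yE ln_sqr//; nra.
move/le_trans; apply; rewrite ler_pM2l// yE.
have -> : x^-1 - 1 = x^-1 * (1 - x) by rewrite mulrBr mulr1 mulVf// gt_eqF.
rewrite exprMn exprVn ler_pM2l ?invr_gt0 ?exprn_gt0//.
by move: h; nra.
Qed.

(** The exponential dominates powers: e^t - 1 is at least t, and at least
    t^N / N! for any N >= q. *)
Lemma powR_ln_le q : 1 <= q -> exists2 C : R, 0 < C &
  forall y, 1 <= y -> ln y `^ q <= C * (y - 1).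
Proof.
move=> q1.
pose N := Num.truncn q.
have qN : q <= N.+1%:R by rewrite ltW// truncnS_gt.
exists (1 + N.+1`!%:R) => [|y y1]; first by rewrite ltr_pwDl.
have y0 : 0 < y by lra.
have t0 := ln_ge0 y1.
have yt : ln y <= y - 1 by rewrite ln_le_sub1.
have yt' : ln y ^+ N.+1 <= N.+1`!%:R * (y - 1).
  have := expR_ge1Dxn N t0; rewrite lnK ?posrE// => h.
  by rewrite mulrC -ler_pdivrMr ?ltr0n ?fact_gt0//; lra.
rewrite mulrDl mul1r.
have [t1|t1] := leP (ln y) 1.
  have : ln y `^ q <= ln y.
    have [->|tn0] := eqVneq (ln y) 0; first by rewrite powR0//; lra.
    by rewrite ge1r_powR// lt_neqAle eq_sym tn0 t0.
  have : 0 <= N.+1`!%:R * (y - 1) by rewrite mulr_ge0// subr_ge0.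
  lra.
have : ln y `^ q <= ln y `^ N.+1%:R by rewrite ler_powR// ltW.
by rewrite powR_mulrn//; lra.
Qed.

(** For y >= 1 the gap is of order (ln y)^2 near 1 and grows faster than any
    power of ln y at infinity, so a smaller power of it still dominates. This
    leaves the whole envelope to pay for the factor max (y, 1) in
    [max_ln_sqr_le]. *)
Lemma ln_sqr_le_gap_powR s : 0 <= s < 1 -> exists2 C : R, 0 < C &
  forall y, 1 <= y -> ln y ^+ 2 <= C * gap y `^ (1 - s).
Proof.
move=> /andP[s0 s1].
have s1' : 0 < 1 - s by lra.
have [|C C0 hC] := @powR_ln_le ((1 - s)^-1); first by rewrite invf_ge1//; lra.
exists (4 * (C ^+ 2) `^ (1 - s)) => [|y y1].
  by rewrite mulr_gt0// powR_gt0// exprn_gt0.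
have [|x x0 yE] := @pos_eq_sqr y; first lra.
have x1 : 1 <= x by move: y1; rewrite yE; nra.
have h := sqr_sub1_le_gap_sqr x0.
have l0 := ln_ge0 x1.
rewrite yE ln_sqr// exprMn -mulrA -natrX ler_pM2l//.
rewrite -powRM ?sqr_ge0 ?gap_ge0 ?exprn_gt0//.
(* It is enough to compare (ln x)^(1/(1-s)) with x - 1, whose square is at
   most the gap. *)
have -> : ln x ^+ 2 = ((ln x `^ (1 - s)^-1) ^+ 2) `^ (1 - s).
  rewrite -powR_mulrn// -[(_ `^ _) ^+ 2]powR_mulrn ?powR_ge0// -!powRrM.
  by congr (_ `^ _); field; rewrite gt_eqF.
apply: ge0_ler_powR; rewrite ?nnegrE.
- exact: ltW.
- exact: sqr_ge0.
- by rewrite mulr_ge0 ?sqr_ge0 ?gap_ge0 ?exprn_gt0.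
apply: (@le_trans _ _ ((C * (x - 1)) ^+ 2)).
  by rewrite lerXn2r ?nnegrE ?powR_ge0 ?hC// mulr_ge0 ?subr_ge0// ltW.
by rewrite exprMn ler_pM2l ?exprn_gt0.
Qed.

(** The second factor of Hoelder's inequality. The logarithm is that of
    max (1/y, 1), so that no logarithm multiplies y^p: only a moment of f_m
    without logarithm then has to be controlled, and Jensen's inequality for
    x |-> x^p suffices. *)
Definition envelope p y : R :=
  y `^ p + Num.max y^-1 1 `^ (p - 1) * ln (Num.max y^-1 1) ^+ 2.

Lemma le_powR_geomean (a x z s : R) :
  0 <= s <= 1 -> 0 <= a -> a <= x -> a <= z ->
  a <= x `^ (1 - s) * z `^ s.
Proof.
move=> /andP[s0 s1] a0 ax az.
have [->|an0] := eqVneq a 0; first by rewrite mulr_ge0 ?powR_ge0.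
have -> : a = a `^ (1 - s) * a `^ s.
  by rewrite -powRD ?subrK ?powRr1// an0 implybT.
rewrite ler_pM ?powR_ge0//; apply: ge0_ler_powR; rewrite ?nnegrE//; lra.
Qed.

Lemma envelope_ge_powR p y : y `^ p <= envelope p y.
Proof. by rewrite lerDl mulr_ge0 ?powR_ge0 ?sqr_ge0. Qed.

Lemma envelope_ge0 p y : 0 <= envelope p y.
Proof. exact: le_trans (powR_ge0 _ _) (envelope_ge_powR _ _). Qed.

Lemma envelope_ge_ln p y : 0 < y <= 1 ->
  y^-1 `^ (p - 1) * ln y ^+ 2 <= envelope p y.
Proof.
move=> /andP[y0 y1]; rewrite /envelope max_l ?invf_ge1//.
by rewrite lnV ?posrE// sqrrN lerDr powR_ge0.
Qed.

Lemma powR4_le s : 0 <= s <= 1 -> (4 : R) `^ s <= 4.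
Proof. by move=> /andP[s0 s1]; apply: ler1_powR => //; rewrite ler1n. Qed.

(** Split (ln y)^2 as its powers 1 - s and s, and bound only the former by
    4 gap y / y. The exponents of 1/y then match exactly: for s = (r+1)/p,
    r + (1 - s) = (p - 1) s. *)
Lemma weighted_ln_sqr_le_le1 p r y : 0 <= r -> r + 1 <= p -> 0 < y <= 1 ->
  y^-1 `^ r * ln y ^+ 2 <=
    4 * (gap y `^ (1 - (r + 1) / p) * envelope p y `^ ((r + 1) / p)).
Proof.
move=> r0 rp /andP[y0 y1]; set s := (r + 1) / p.
have p0 : 0 < p by lra.
have s01 : 0 <= s <= 1 by rewrite divr_ge0/= ?ler_pdivrMr//; lra.
have g0 := gap_ge0 y0.
have y'0 : 0 < y^-1 by rewrite invr_gt0.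
have rE : r + (1 - s) = (p - 1) * s.
  by rewrite /s; field; rewrite gt_eqF.
have h1 := ln_sqr_le_gap_le1 y0 y1.
have h2 : ln y ^+ 2 <= (4 * (y^-1 * gap y)) `^ (1 - s) * (ln y ^+ 2) `^ s.
  by apply: le_powR_geomean => //; rewrite ?sqr_ge0// !mulr_ge0// ltW.
apply: (@le_trans _ _ (y^-1 `^ r *
    ((4 * (y^-1 * gap y)) `^ (1 - s) * (ln y ^+ 2) `^ s))).
  by rewrite ler_wpM2l ?powR_ge0.
rewrite (@powRM _ 4) ?mulr_ge0 ?(ltW y'0)// (@powRM _ y^-1) ?(ltW y'0)//.
set a4 := 4 `^ _.
have a44 : a4 <= 4 by apply: powR4_le; move: s01; lra.
have h3 : y^-1 `^ r * y^-1 `^ (1 - s) * (ln y ^+ 2) `^ s <= envelope p y `^ s.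
  rewrite -powRD; last by rewrite (gt_eqF y'0) implybT.
  rewrite rE powRrM -powRM ?powR_ge0 ?sqr_ge0//.
  apply: ge0_ler_powR; rewrite ?nnegrE ?(mulr_ge0 (powR_ge0 _ _) (sqr_ge0 _))//.
  - by case/andP: (s01).
  - exact: envelope_ge0.
  - by rewrite envelope_ge_ln ?y0.
apply: (@le_trans _ _ (a4 * (gap y `^ (1 - s) *
    (y^-1 `^ r * y^-1 `^ (1 - s) * (ln y ^+ 2) `^ s)))).
  lra.
by apply: ler_pM; rewrite ?mulr_ge0 ?powR_ge0// ler_wpM2l ?powR_ge0.
Qed.

(** The weight is 1 here, and (ln y)^2 is at most both 4 gap y and 4 y^p. *)
Lemma ln_sqr_le_ge1 p r y : 0 <= r -> r + 1 <= p -> 1 <= y ->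
  ln y ^+ 2 <=
    4 * (gap y `^ (1 - (r + 1) / p) * envelope p y `^ ((r + 1) / p)).
Proof.
move=> r0 rp y1; set s := (r + 1) / p.
have y0 : 0 < y by lra.
have p1 : 1 <= p by lra.
have s01 : 0 <= s <= 1 by rewrite divr_ge0/= ?ler_pdivrMr//; lra.
have g0 := gap_ge0 y0.
have h1 := ln_sqr_le_gap_ge1 y1.
have E0 := envelope_ge0 p y.
have h2 : ln y ^+ 2 <= 4 * envelope p y.
  have := envelope_ge_powR p y; have := le1r_powR y1 p1.
  have := ln_ge0 y1; move: h1; rewrite /gap; lra.
have : ln y ^+ 2 <= (4 * gap y) `^ (1 - s) * (4 * envelope p y) `^ s.
  by apply: le_powR_geomean => //; rewrite ?sqr_ge0// !mulr_ge0.
rewrite !(@powRM _ 4)// mulrACA -powRD; last by rewrite pnatr_eq0 implybT.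
by rewrite subrK powRr1.
Qed.

Lemma max_ln_sqr_le p : 1 < p -> exists2 C : R, 0 < C &
  forall y, 0 < y -> Num.max y 1 * ln y ^+ 2 <=
    C * (gap y `^ (1 - 1 / p) * envelope p y `^ (1 / p)).
Proof.
move=> p1; have p0 : 0 < p by lra.
have [|C C0 hC] := @ln_sqr_le_gap_powR (1 / p).
  by rewrite divr_ge0/= ?ltr_pdivrMr//; lra.
exists (C + 4) => [|y y0]; first lra.
have X0 : 0 <= gap y `^ (1 - 1 / p) * envelope p y `^ (1 / p).
  by rewrite mulr_ge0 ?powR_ge0.
rewrite mulrDl; have [y1|y1] := leP y 1.
  have := @weighted_ln_sqr_le_le1 p 0 y (lexx _).
  rewrite add0r powRr0 !mul1r => /(_ (ltW p1)); rewrite y0 y1 => /(_ isT).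
  have := mulr_ge0 (ltW C0) X0; rewrite mul1r; lra.
(* Only the factor y is charged to the envelope, through y = (y^p)^(1/p). *)
have h1 := hC _ (ltW y1).
have h2 : y <= envelope p y `^ (1 / p).
  have {1}-> : y = (y `^ p) `^ (1 / p).
    by rewrite -powRrM mul1r divff ?powRr1 ?gt_eqF// ltW.
  apply: ge0_ler_powR; rewrite ?nnegrE ?powR_ge0 ?envelope_ge_powR//.
    by rewrite divr_ge0// ltW.
  exact: envelope_ge0.
have : y * ln y ^+ 2 <= envelope p y `^ (1 / p) * (C * gap y `^ (1 - 1 / p)).
  by apply: ler_pM => //; rewrite ?sqr_ge0// ltW.
lra.
Qed.

Lemma max_powR_ln_sqr_le p r y : 0 <= r -> r + 1 <= p -> 0 < y ->
  Num.max y^-1 1 `^ r * ln y ^+ 2 <=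
    4 * (gap y `^ (1 - (r + 1) / p) * envelope p y `^ ((r + 1) / p)).
Proof.
move=> r0 rp y0; have [y1|y1] := leP y 1.
  by rewrite max_l ?invf_ge1// weighted_ln_sqr_le_le1 ?y0.
rewrite max_r ?invf_le1 ?(ltW y1)// powR1 mul1r.
by rewrite ln_sqr_le_ge1// ltW.
Qed.

(** When the ratios are bounded, the weight is absorbed in the constant. *)
Lemma max_ln_sqr_le_bounded K y : 1 <= K -> 0 < y ->
  y <= K -> y^-1 <= K -> Num.max y 1 * ln y ^+ 2 <= 4 * K * gap y.
Proof.
move=> K1 y0 yK y'K; have g0 := gap_ge0 y0.
have [y1|y1] := leP y 1.
  rewrite mul1r; have := ln_sqr_le_gap_le1 y0 y1.
  by have := ler_wpM2r g0 y'K; lra.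
have := ln_sqr_le_gap_ge1 (ltW y1).
by have := sqr_ge0 (ln y); nra.
Qed.

Lemma max_powR_ln_sqr_le_bounded K r y : 1 <= K ->
  0 <= r -> 0 < y -> y^-1 <= K ->
  Num.max y^-1 1 `^ r * ln y ^+ 2 <= 4 * K `^ (r + 1) * gap y.
Proof.
move=> K1 r0 y0 y'K; have g0 := gap_ge0 y0.
have KE : K `^ (r + 1) = K * K `^ r.
  by rewrite -[in RHS](addrK 1 r) mulr_powRB1//; lra.
have Kr1 : 1 <= K `^ r by rewrite -[leLHS](powRr0 K) ler_powR.
rewrite KE; have [y1|y1] := leP y 1.
  rewrite max_l ?invf_ge1//.
  have h1 : ln y ^+ 2 <= 4 * (K * gap y).
    apply: (le_trans (ln_sqr_le_gap_le1 y0 y1)).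
    by rewrite ler_pM2l// ler_wpM2r.
  have h2 : y^-1 `^ r <= K `^ r.
    by apply: ge0_ler_powR; rewrite ?nnegrE ?invr_ge0 ?(ltW y0)//; lra.
  have := ler_pM (powR_ge0 _ _) (sqr_ge0 _) h2 h1.
  by move/le_trans; apply; lra.
rewrite max_r ?invf_le1 ?(ltW y1)// powR1 mul1r.
apply: (le_trans (ln_sqr_le_gap_ge1 (ltW y1))).
by rewrite ler_wpM2r// ler_peMr// mulr_ege1.
Qed.

(** Here f and m are values of the density and of its projection. The bound
    m >= A gives max (f/m, 1) <= f/A, which removes m from the logarithmic
    term. *)
Lemma mul_envelope_le (A p f m : R) : 0 < A -> 1 < p ->
  A <= f -> A <= m ->
  f * envelope p (m / f) <= A^-1 `^ (p - 1) *
    (m `^ p + 2 * (1 + ln A ^+ 2) * (f `^ p * Num.max (ln f ^+ 2) 1)).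
Proof.
move=> A0 p1 Af Am.
have f0 : 0 < f by lra.
have m0 : 0 < m by lra.
have p0 : 0 < p by lra.
have A'0 : 0 <= A^-1 by rewrite invr_ge0 ltW.
have f'0 : 0 <= f^-1 by rewrite invr_ge0 ltW.
rewrite /envelope invf_div mulrDr [leRHS]mulrDr; apply: lerD.
  rewrite powRM ?(ltW m0)// mulrCA [leRHS]mulrC ler_wpM2l ?powR_ge0//.
  rewrite -(mulr_powRB1 f'0 p0) mulrA mulfV ?mul1r ?gt_eqF//.
  by apply: ge0_ler_powR; rewrite ?nnegrE ?lef_pV2// subr_ge0 ltW.
set v := Num.max _ _.
have v1 : 1 <= v by rewrite le_max lexx orbT.
have vA : v <= f / A.
  by rewrite ge_max ler_pM2l// lef_pV2 ?posrE// Am ler_pdivlMr// mul1r.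
have fA0 : 0 <= f / A by lra.
have lnvA : ln v <= ln f - ln A.
  by rewrite -ln_div ?posrE// ler_ln ?posrE//; lra.
have lnv0 := ln_ge0 v1.
have h1 : ln v ^+ 2 <= 2 * (1 + ln A ^+ 2) * Num.max (ln f ^+ 2) 1.
  have M1 : 1 <= Num.max (ln f ^+ 2) 1 by rewrite le_max lexx orbT.
  have Mf : ln f ^+ 2 <= Num.max (ln f ^+ 2) 1 by rewrite le_max lexx.
  move: (Num.max _ _) M1 Mf => M M1 Mf.
  have h : ln v ^+ 2 <= 2 * (ln f ^+ 2 + ln A ^+ 2).
    by have := sqr_ge0 (ln f + ln A); nra.
  by have := mulr_ge0 (sqr_ge0 (ln A)) (_ : 0 <= M - 1); nra.
have h2 : v `^ (p - 1) <= f `^ (p - 1) * A^-1 `^ (p - 1).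
  rewrite -powRM ?(ltW f0)//; apply: ge0_ler_powR; rewrite ?nnegrE//; lra.
rewrite -(mulr_powRB1 (ltW f0) p0).
apply: (@le_trans _ _ (f * ((f `^ (p - 1) * A^-1 `^ (p - 1)) *
    (2 * (1 + ln A ^+ 2) * Num.max (ln f ^+ 2) 1)))).
  by rewrite ler_pM2l//; apply: ler_pM => //; rewrite ?powR_ge0 ?sqr_ge0.
lra.
Qed.

End RealInequalities.

(** * Measurability *)

Lemma measurable_powRl d (Z : measurableType d) (R : realType) (g : Z -> R) (a : R) :
  measurable_fun setT g -> measurable_fun setT (fun z => g z `^ a).
Proof. exact: (@measurableT_comp _ _ _ _ _ _ (@powR R ^~ a)). Qed.

Lemma measurable_lnr d (Z : measurableType d) (R : realType) (g : Z -> R) :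
  measurable_fun setT g -> measurable_fun setT (fun z => ln (g z)).
Proof. exact: (@measurableT_comp _ _ _ _ _ _ (@ln R)). Qed.

(** Through the identity 1/x = x (x^2)^(-1), which holds also at x = 0. *)
Lemma measurable_invr d (Z : measurableType d) (R : realType) (g : Z -> R) :
  measurable_fun setT g -> measurable_fun setT (fun z => (g z)^-1).
Proof.
move=> mg; rewrite (_ : (fun z => _) = (fun z => g z * (g z ^+ 2) `^ (-1))).
  by apply: measurable_funM => //; apply/measurable_powRl/measurable_funX.
apply/funext => z; rewrite powR_inv1 ?sqr_ge0//.
by have [->|gz0] := eqVneq (g z) 0; [rewrite invr0 mul0r|field].
Qed.

Lemma measurable_gap d (Z : measurableType d) (R : realType) (g : Z -> R) :
  measurable_fun setT g -> measurable_fun setT (fun z => gap (g z)).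
Proof.
move=> mg; apply: measurable_funB; last exact: measurable_lnr.
exact: measurable_funB.
Qed.

Lemma measurable_envelope d (Z : measurableType d) (R : realType) (g : Z -> R) p :
  measurable_fun setT g -> measurable_fun setT (fun z => envelope p (g z)).
Proof.
move=> mg; apply: measurable_funD; first exact: measurable_powRl.
have mm : measurable_fun setT (fun z => Num.max (g z)^-1 1).
  by apply: measurable_maxr => //; exact: measurable_invr.
apply: measurable_funM; first exact: measurable_powRl.
by apply: measurable_funX; exact: measurable_lnr.
Qed.

(** * Hoelder's inequality and change of measure *)

(** Hoelder's inequality with exponents 1/(1-s) and 1/s, in a form that remains
    true at s = 1, which is the case r = p - 1 of the theorem. *)
Lemma integral_geomean_le d (Z : measurableType d) (R : realType)
    (P : {measure set Z -> \bar R}) (F G : Z -> R) (s : R) : 0 < s <= 1 ->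
  measurable_fun setT F -> measurable_fun setT G ->
  (forall z, 0 <= F z) -> (forall z, 0 <= G z) ->
  (\int[P]_z (F z `^ (1 - s) * G z `^ s)%:E <=
    (\int[P]_z (F z)%:E) `^ (1 - s) * (\int[P]_z (G z)%:E) `^ s)%E.
Proof.
move=> /andP[s0]; rewrite le_eqVlt => /predU1P[->|s1] mF mG F0 G0.
  rewrite subrr poweRe0 mul1e poweRe1; last first.
    by apply: integral_ge0 => z _; rewrite lee_fin.
  by under eq_integral do rewrite powRr0 mul1r powRr1//.
have s1' : 0 < 1 - s by rewrite subr_gt0.
have := @hoelder _ _ _ P (fun z => F z `^ (1 - s)) (fun z => G z `^ s)
  (1 - s)^-1 s^-1 (measurable_powRl _ mF) (measurable_powRl _ mG).
rewrite !invr_gt0 !invrK subrK => /(_ s1' s0 erefl).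
rewrite Lnorm1 unlock !invrK.
have E (H : Z -> R) (a : R) : 0 < a -> (forall z, 0 <= H z) ->
    (\int[P]_z `|(EFin \o (fun z => (H z `^ a)%R)) z| `^ (a^-1)%R =
     \int[P]_z (H z)%:E)%E.
  move=> a0 H0; apply: eq_integral => z _ /=.
  by rewrite ger0_norm ?powR_ge0// -powRrM divff ?powRr1// gt_eqF.
move=> h.
have <- : (\int[P]_z
    `|(EFin \o ((fun z => F z `^ (1 - s)) \* (fun z => G z `^ s))%R) z| =
   \int[P]_z (F z `^ (1 - s) * G z `^ s)%:E)%E.
  by apply: eq_integral => z _ /=; rewrite ger0_norm// mulr_ge0 ?powR_ge0.
apply: (le_trans h).
by rewrite le_eqVlt; apply/orP; left; apply/eqP; congr (_ `^ _ * _ `^ _)%E; exact: E.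
Qed.

Section Density.
Context {d : measure_display} {Z : measurableType d} {R : realType}.
Context (mu P : probability Z R) (f : Z -> R).
Context (fP : is_density mu P f).

Let mf : measurable_fun setT f. Proof. by case: fP. Qed.
Let f0 z : 0 <= f z. Proof. by case: fP. Qed.

Lemma density_dominates : P `<< mu.
Proof.
apply/null_content_dominatesP => A mA A0; case: fP => _ _ ->//.
apply: null_set_integral => //; apply: measurable_funTS.
exact/measurable_EFinP.
Qed.

Lemma integral_density_setT : (\int[mu]_z (f z)%:E = 1)%E.
Proof. by case: fP => _ _ <-//; exact: probability_setT. Qed.

Lemma integrable_density : mu.-integrable setT (EFin \o f).
Proof.
apply/integrableP; split; first exact/measurable_EFinP.
rewrite (eq_integral (fun z => (f z)%:E)); last first.
  by move=> z _; rewrite /= ger0_norm.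
by rewrite integral_density_setT ltry.
Qed.

(** The given density agrees almost everywhere with the Radon-Nikodym
    derivative, for which the change of variables is known. *)
Lemma ge0_integral_density (g : Z -> R) : measurable_fun setT g ->
  (forall z, 0 <= g z) ->
  (\int[P]_z (g z)%:E = \int[mu]_z (f z * g z)%:E)%E.
Proof.
move=> mg g0.
have PM := density_dominates.
rewrite -(Radon_Nikodym_SigmaFinite.change_of_variables PM)//;
  last exact/measurable_EFinP.
have mRN := Radon_Nikodym_SigmaFinite.f_integrable PM.
have mRN' := measurable_int _ mRN.
apply: ge0_ae_eq_integral => //.
- by apply: emeasurable_funM => //; exact/measurable_EFinP.
- by apply/measurable_EFinP/measurable_funM.
- by move=> z _; rewrite mule_ge0 ?lee_fin// Radon_Nikodym_SigmaFinite.f_ge0.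
- by move=> z _; rewrite lee_fin mulr_ge0.
have : ae_eq mu setT (Radon_Nikodym_SigmaFinite.f P mu) (EFin \o f).
  apply: integral_ae_eq => //; first exact/measurable_EFinP.
  move=> E _ mE; rewrite -Radon_Nikodym_SigmaFinite.f_integral//.
  by case: fP => _ _ h; exact: h.
by apply: filterS => z /= -> //; rewrite -EFinM mulrC.
Qed.

End Density.

(** * Histograms *)

Section Histogram.
Context {d : measure_display} {Z : measurableType d} {R : realType}.
Context (mu : probability Z R) (Lambda : set (set Z)).
Context (HL : histogram_partition mu Lambda).

Let finL : finite_set Lambda. Proof. by case: HL. Qed.
Let mL I : Lambda I -> measurable I. Proof. by case: HL => _ _ h /h[]. Qed.

Definition stepfun (b : set Z -> R) z := \sum_(I \in Lambda) b I * \1_I z.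

Lemma stepfunE b I z : Lambda I -> I z -> stepfun b z = b I.
Proof.
move=> LI Iz; rewrite /stepfun (fsbigD1 I)/=; last 2 first.
- exact: finL.
- exact: LI.
rewrite indicE mem_set// mulr1 fsbig1 ?addr0// => K [LK KI].
rewrite indicE memNset ?mulr0// => Kz; apply: KI.
by case: HL => _ [_ tr _] _; apply: tr => //; exists z.
Qed.

Lemma exists_cell z : exists2 I, Lambda I & I z.
Proof.
case: HL => _ [cov _ _] _.
by have : setT z by []; rewrite -cov => -[I LI Iz]; exists I.
Qed.

Lemma measurable_stepfun b : measurable_fun setT (stepfun b).
Proof.
apply/measurable_EFinP.
rewrite (_ : _ \o _ = fun z => \sum_(I \in Lambda)
    (if I \in Lambda then b I * \1_I z else 0)%:E)%E; last first.
  apply/funext => z /=; rewrite fsumEFin//; congr EFin.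
  by apply: eq_fsbigr => I ->.
apply: emeasurable_fsum => // I; apply/measurable_EFinP.
case: (boolP (I \in Lambda)) => [/set_mem LI|_]; last exact: measurable_cst.
by apply: measurable_funM => //; apply: measurable_indic; exact: mL.
Qed.

Lemma integral_mul_stepfun (g : Z -> R) b : measurable_fun setT g ->
  (forall z, 0 <= g z) -> (forall I, Lambda I -> 0 <= b I) ->
  (\int[mu]_z (g z * stepfun b z)%:E =
   \sum_(I \in Lambda) (b I)%:E * \int[mu]_(z in I) (g z)%:E)%E.
Proof.
move=> mg g0 b0.
(* Outside Lambda a set need not be measurable, so its term is cut to 0. *)
pose h I z := if I \in Lambda then (b I * (g z * \1_I z)) else 0.
transitivity (\int[mu]_z (\sum_(I \in Lambda) (h I z)%:E))%E.
  apply: eq_integral => z _; rewrite fsumEFin// /stepfun; congr EFin.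
  rewrite fsbig_distrr//; apply: eq_fsbigr => I LI.
  by rewrite /h LI mulrCA.
rewrite ge0_integral_fsum//; last 2 first.
- move=> I; apply/measurable_EFinP; rewrite /h.
  case: (boolP (I \in Lambda)) => [/set_mem LI|_].
    apply: measurable_funM => //; apply: measurable_funM => //.
    by apply: measurable_indic; exact: mL.
  exact: measurable_cst.
- move=> I z _; rewrite lee_fin /h; case: ifPn => // /set_mem LI.
  by rewrite mulr_ge0 ?b0// mulr_ge0.
apply: eq_fsbigr => I LI; rewrite /h LI; have {}LI := set_mem LI.
under eq_integral do rewrite EFinM.
rewrite ge0_integralZl_EFin//; last 3 first.
- by move=> z _; rewrite lee_fin mulr_ge0.
- apply/measurable_EFinP; apply: measurable_funM => //.
  by apply: measurable_indic; exact: mL.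
- exact: b0.
congr (_ * _)%E; rewrite [in RHS]integral_mkcond.
apply: eq_integral => z _; rewrite patchE indicE.
by case: (z \in I); rewrite ?mulr1 ?mulr0.
Qed.

End Histogram.

Section Projection.
Context {d : measure_display} {Z : measurableType d} {R : realType}.
Context (mu P : probability Z R) (f : Z -> R) (A : R).
Context (fP : is_density mu P f) (A0 : 0 < A) (Af : forall z, A <= f z).
Context (Lambda : set (set Z)) (HL : histogram_partition mu Lambda).

Let mf : measurable_fun setT f. Proof. by case: fP. Qed.
Let f0 z : 0 <= f z. Proof. by case: fP. Qed.
Let c (I : set Z) : R := fine (P I) / fine (mu I).
Let fm := histogram_proj mu P Lambda.

Let finL : finite_set Lambda. Proof. by case: HL. Qed.
Let mL I : Lambda I -> measurable I. Proof. by case: HL => _ _ h /h[]. Qed.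

Let muI_gt0 I : Lambda I -> 0 < fine (mu I).
Proof.
case: HL => _ _ h /h[mI muI]; rewrite fine_gt0// muI/=.
by rewrite (le_lt_trans (probability_le1 mu mI))// ltry.
Qed.

Let fineKmu I : Lambda I -> ((fine (mu I))%:E = mu I)%E.
Proof. by move=> /mL mI; rewrite fineK// fin_num_measure. Qed.

Let fineKP I : Lambda I -> ((fine (P I))%:E = P I)%E.
Proof. by move=> /mL mI; rewrite fineK// fin_num_measure. Qed.

Lemma measurable_histogram_proj : measurable_fun setT fm.
Proof. exact: (measurable_stepfun HL). Qed.
Let mfm := measurable_histogram_proj.

Lemma histogram_projE I z : Lambda I -> I z -> fm z = c I.
Proof. by move=> LI Iz; exact: (stepfunE HL _ LI Iz). Qed.

Lemma histogram_proj_ge z : A <= fm z.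
Proof.
have [I LI Iz] := exists_cell HL z.
rewrite (histogram_projE LI Iz).
rewrite ler_pdivlMr ?muI_gt0// -lee_fin EFinM fineKmu// fineKP//.
case: fP => _ _ ->; last exact: mL.
rewrite -integral_cst; last exact: mL.
apply: ge0_le_integral => //.
- exact: mL.
- by move=> z' _; rewrite lee_fin ltW.
- by apply/measurable_funTS/measurable_EFinP.
- by move=> z' _; rewrite lee_fin.
Qed.

Let fm_gt0 z : 0 < fm z. Proof. exact: lt_le_trans (histogram_proj_ge z). Qed.

Lemma histogram_proj_le (B : R) : {ae mu, forall z, f z <= B} ->
  forall z, fm z <= B.
Proof.
move=> fB z; have [I LI Iz] := exists_cell HL z.
rewrite (histogram_projE LI Iz).
rewrite ler_pdivrMr ?muI_gt0// -lee_fin EFinM fineKmu// fineKP//.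
case: fP => _ _ ->; last exact: mL.
have B0 : 0 <= B.
  have [//|B0] := leP 0 B.
  have : mu setT = 0%E.
    have [N [mN N0 sN]] := fB.
    have -> : setT = N.
      apply/seteqP; split => // x _; apply: sN => /= fx.
      by have := lt_le_trans B0 (f0 x); rewrite ltNge fx.
    exact: N0.
  by rewrite probability_setT => /eqP; rewrite onee_eq0.
rewrite -integral_cst; last exact: mL.
apply: ae_ge0_le_integral => //.
- exact: mL.
- by move=> z' _; rewrite lee_fin.
- by apply/measurable_funTS/measurable_EFinP.
- case: fB => N [mN N0 sN]; exists N; split=> //; apply: subset_trans sN.
  by apply: subsetC => x /= fx _; rewrite lee_fin.
Qed.

(** The bound depends on the partition; it is used for finiteness only. *)
Lemma histogram_proj_bounded : exists M, forall z, fm z <= M.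
Proof.
exists (\sum_(I \in Lambda) c I) => z.
have c0 I : Lambda I -> 0 <= c I by move=> LI; rewrite divr_ge0// fine_ge0.
have [I LI Iz] := exists_cell HL z.
rewrite (histogram_projE LI Iz).
rewrite (fsbigD1 I)//= lerDl; by apply: fsumr_ge0 => K [/c0].
Qed.

(** The projection is the conditional expectation of f given the partition:
    f and f_m have the same integral on each cell, hence against any function
    of f_m. *)
Lemma integral_histogram_proj (g : R -> R) : (forall x, 0 <= g x) ->
  (\int[mu]_z (f z * g (fm z))%:E = \int[mu]_z (fm z * g (fm z))%:E)%E.
Proof.
move=> g0.
have E z : g (fm z) = stepfun Lambda (g \o c) z.
  have [I LI Iz] := exists_cell HL z.
  rewrite (stepfunE HL _ LI Iz) /fm.
  by rewrite [histogram_proj _ _ _ _](stepfunE HL _ LI Iz).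
under eq_integral do rewrite E.
under [in RHS]eq_integral do rewrite E.
rewrite !(integral_mul_stepfun HL)//; try by move=> *; exact: g0.
  2: by move=> z; exact: ltW.
apply: eq_fsbigr => I /set_mem LI; congr (_ * _)%E.
case: fP => _ _ <-; last exact: mL.
have -> : (P I = (c I)%:E * mu I)%E.
  by rewrite -fineKmu// -EFinM divfK ?gt_eqF ?muI_gt0// fineKP.
rewrite -integral_cst; last exact: mL.
by apply: eq_integral => z /set_mem Iz /=; rewrite (histogram_projE LI Iz).
Qed.

Lemma integral_histogram_proj_setT : (\int[mu]_z (fm z)%:E = 1)%E.
Proof.
have := @integral_histogram_proj (cst 1) (fun=> ler01) => /=.
under eq_integral do rewrite mulr1.
under [in RHS]eq_integral do rewrite mulr1.
by move=> <-; rewrite (integral_density_setT fP).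
Qed.

(** Jensen's inequality for conditional expectations. Young's inequality bounds
    f f_m^(p-1) by f^p / p + (1 - 1/p) f_m^p, and the left side has the same
    integral X as f_m^p; X being finite, its part (1 - 1/p) X can be
    subtracted. *)
Lemma integral_powR_histogram_proj_le p : 1 < p ->
  (\int[mu]_z (fm z `^ p)%:E <= \int[mu]_z (f z `^ p)%:E)%E.
Proof.
move=> p1; have p0 : 0 < p by lra.
set X := (\int[mu]_z (fm z `^ p)%:E)%E; set Y := (\int[mu]_z (f z `^ p)%:E)%E.
have [M fmM] := histogram_proj_bounded.
have X0 : (0 <= X)%E by apply: integral_ge0 => z _; rewrite lee_fin powR_ge0.
have Xfin : X \is a fin_num.
  rewrite ge0_fin_numE//.
  apply: (@le_lt_trans _ _ (\int[mu]_z (cst (M `^ p)%:E z))%E).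
    apply: ge0_le_integral => //.
    - by move=> z _; rewrite lee_fin powR_ge0.
    - by apply/measurable_EFinP/measurable_powRl.
    - move=> z _; rewrite lee_fin; apply: ge0_ler_powR; rewrite ?nnegrE ?(ltW p0)//.
        exact: ltW.
      exact: le_trans (ltW (fm_gt0 z)) (fmM z).
  by rewrite integral_cst// [X in (_ * X)%E]probability_setT mule1 ltry.
have p'0 : 0 < p^-1 by rewrite invr_gt0.
have q'0 : 0 < 1 - p^-1 by rewrite subr_gt0 invf_lt1.
have : (X <= p^-1%:E * Y + (1 - p^-1)%:E * X)%E.
  have {1}-> : X = (\int[mu]_z (f z * fm z `^ (p - 1))%:E)%E.
    rewrite (@integral_histogram_proj (fun x => x `^ (p - 1))) => [|x];
      last exact: powR_ge0.
    by apply: eq_integral => z _; rewrite mulr_powRB1// ltW.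
  have mfp : measurable_fun setT (fun z => (f z `^ p)%:E).
    by apply/measurable_EFinP/measurable_powRl.
  have mfmp : measurable_fun setT (fun z => (fm z `^ p)%:E).
    by apply/measurable_EFinP/measurable_powRl.
  rewrite -!ge0_integralZl_EFin//; try by
    [exact: ltW | move=> z _; rewrite lee_fin powR_ge0].
  rewrite -ge0_integralD//; try by
    [ exact: measurable_funeM
    | move=> z _; rewrite -EFinM lee_fin mulr_ge0 ?powR_ge0// ltW].
  apply: ge0_le_integral => //.
  - by move=> z _; rewrite lee_fin mulr_ge0 ?powR_ge0.
  - by apply/measurable_EFinP/measurable_funM => //; exact: measurable_powRl.
  - by apply: emeasurable_funD; exact: measurable_funeM.
  move=> z _; rewrite -!EFinM -EFinD lee_fin.
  have := @conjugate_powR _ (f z) (fm z `^ (p - 1)) p (1 - p^-1)^-1.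
  rewrite invrK invr_gt0 => /(_ (f0 z) (powR_ge0 _ _) p0 q'0).
  rewrite subrKC => /(_ erefl); rewrite -powRrM mulrC [_ / p]mulrC.
  move=> /le_trans; apply; rewrite lerD2l mulrC.
  by have -> : (p - 1) / (1 - p^-1) = p by field; lra.
case: (Y) => [y||].
- rewrite -(fineK Xfin) -!EFinM -EFinD !lee_fin => h.
  by rewrite -(ler_pM2l p'0); lra.
- by rewrite leey.
- by rewrite mulrNy gtr0_sg// mul1e addNye leeNy_eq => /eqP XE; move: X0; rewrite XE.
Qed.

End Projection.

(** * The divergence of the projection *)

Section Divergence.
Context {d : measure_display} {Z : measurableType d} {R : realType}.
Context (mu P : probability Z R) (f : Z -> R) (A : R).
Context (fP : is_density mu P f) (A0 : 0 < A) (Af : forall z, A <= f z).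
Context (Lambda : set (set Z)) (HL : histogram_partition mu Lambda).
Context (p J : R) (p1 : 1 < p).
Context (HJ : (\int[mu]_z (f z `^ p * Num.max (ln (f z) ^+ 2) 1)%:E)%E = J%:E).

Let mf : measurable_fun setT f. Proof. by case: fP. Qed.
Let f_gt0 z : 0 < f z. Proof. exact: lt_le_trans (Af z). Qed.
Let fm := histogram_proj mu P Lambda.
Let mfm : measurable_fun setT fm := measurable_histogram_proj P HL.
Let fm_ge z : A <= fm z := histogram_proj_ge fP A0 Af HL z.
Let fm_gt0 z : 0 < fm z. Proof. exact: lt_le_trans (fm_ge z). Qed.
Let y z := fm z / f z.
Let y_gt0 z : 0 < y z. Proof. by rewrite divr_gt0. Qed.
Let my : measurable_fun setT y.
Proof. by apply: measurable_funM => //; exact: measurable_invr. Qed.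
Let w z := f z `^ p * Num.max (ln (f z) ^+ 2) 1.
Let mw : measurable_fun setT w.
Proof.
apply: measurable_funM; first exact: measurable_powRl.
by apply: measurable_maxr => //; apply/measurable_funX/measurable_lnr.
Qed.
Let w_ge0 z : 0 <= w z.
Proof. by rewrite mulr_ge0 ?powR_ge0// le_max sqr_ge0. Qed.

Lemma integrable_moment : mu.-integrable setT (EFin \o w).
Proof.
apply/integrableP; split; first exact/measurable_EFinP.
rewrite (eq_integral (fun z => (w z)%:E)); last first.
  by move=> z _; rewrite /= ger0_norm.
by rewrite HJ ltry.
Qed.

(** As f >= A, the moment J controls f |ln f|, and ln f_m is bounded. *)
Lemma integrable_KL_integrand :
  mu.-integrable setT (EFin \o (fun z => f z * ln (f z / fm z))).
Proof.
have [M fmM] := histogram_proj_bounded P HL.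
pose K := `|ln A| + `|ln M| + 1.
pose C := A^-1 `^ (p - 1) * K.
have C0 : 0 <= C by rewrite mulr_ge0 ?powR_ge0// !addr_ge0.
apply: (@le_integrable _ _ _ mu setT _ _ (EFin \o (fun z => C * w z))) => //.
- apply/measurable_EFinP/measurable_funM => //; apply: measurable_lnr.
  by apply: measurable_funM => //; exact: measurable_invr.
- move=> z _ /=; rewrite lee_fin (ger0_norm (mulr_ge0 C0 (w_ge0 z))).
  rewrite normrM ger0_norm ?(ltW (f_gt0 z))// /w.
  have fz := f_gt0 z; have p0 : 0 < p := lt_trans ltr01 p1.
  have A1f : f z <= A^-1 `^ (p - 1) * f z `^ p.
    rewrite -(mulr_powRB1 (ltW fz) p0) mulrCA ler_peMr ?(ltW fz)//.
    rewrite -powRM ?invr_ge0 ?(ltW A0) ?(ltW fz)//.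
    rewrite -[leLHS](powRr0 (A^-1 * f z)).
    apply: ler_powR; last by rewrite subr_ge0 ltW.
    by rewrite mulrC ler_pdivlMr// mul1r.
  have M0 : 0 < M := lt_le_trans (fm_gt0 z) (fmM z).
  have lnfm : `|ln (fm z)| <= `|ln A| + `|ln M|.
    have h1 : ln A <= ln (fm z) by rewrite ler_ln ?posrE.
    have h2 : ln (fm z) <= ln M by rewrite ler_ln ?posrE.
    have := ler_norm (ln M); have := ler_norm (- ln A); rewrite normrN.
    have := normr_ge0 (ln M); have := normr_ge0 (ln A).
    by rewrite ler_norml => *; apply/andP; split; lra.
  have lnf : `|ln (f z)| <= Num.max (ln (f z) ^+ 2) 1.
    rewrite le_max -[ln (f z) ^+ 2]real_normK ?num_real//.
    have [h|h] := leP `|ln (f z)| 1; first by rewrite orbT.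
    by rewrite expr2 ler_peMr// ltW.
  have M1 : 1 <= Num.max (ln (f z) ^+ 2) 1 by rewrite le_max lexx orbT.
  have : `|ln (f z / fm z)| <= K * Num.max (ln (f z) ^+ 2) 1.
    rewrite ln_div ?posrE//; apply: (le_trans (ler_normB _ _)).
    have := normr_ge0 (ln M); have := normr_ge0 (ln A).
    by rewrite /K; move: lnfm lnf M1; nra.
  move=> h; rewrite /C; have {}h := ler_pM (ltW fz) (normr_ge0 _) A1f h.
  by apply: (le_trans h); lra.
- rewrite (_ : _ \o _ = fun z => C%:E * (EFin \o w) z)%E.
    by apply: integrableZl => //; exact: integrable_moment.
  by apply/funext => z /=; rewrite EFinM.
Qed.

(** f * gap (f_m / f) = (f_m - f) + f ln (f / f_m), and f_m - f integrates to 0.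
    The absolute continuity required by the definition of KL holds because
    f_m >= A, so that a null set of the measure f_m dmu is null for mu. *)
Lemma KL_eq_integral_gap : KL mu f fm = (\int[P]_z (gap (y z))%:E)%E.
Proof.
rewrite (ge0_integral_density fP); last 2 first.
- exact: measurable_gap.
- by move=> z; exact: gap_ge0.
have fmP : mu.-integrable setT (EFin \o fm).
  apply/integrableP; split; first exact/measurable_EFinP.
  rewrite (eq_integral (fun z => (fm z)%:E)); last first.
    by move=> z _; rewrite /= ger0_norm// ltW.
  by rewrite (integral_histogram_proj_setT fP A0 Af HL) ltry.
have fint := integrable_density fP.
rewrite /KL asboolT; last first.
  move=> E nE B mB BE; apply: null_set_integral => //.
    by apply/measurable_funTS/measurable_EFinP.
  have fB := nE _ mB BE.
  have : (A%:E * mu B <= 0)%E.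
    rewrite -fB -integral_cst//; apply: ge0_le_integral => //.
    - by move=> z _; rewrite lee_fin ltW.
    - by apply/measurable_funTS/measurable_EFinP.
    - by move=> z _; rewrite lee_fin.
  by rewrite pmule_rle0// measure_le0 => /eqP.
transitivity (\int[mu]_z ((fm z)%:E - (f z)%:E) +
    \int[mu]_z (f z * ln (f z / fm z))%:E)%E.
  rewrite integralB_EFin// (integral_density_setT fP).
  by rewrite (integral_histogram_proj_setT fP A0 Af HL) subee// add0e.
rewrite -integralD//; last 2 first.
- by apply: (integrableB _ fmP fint).
- exact: integrable_KL_integrand.
apply: eq_integral => z _; rewrite -EFinB -EFinD; congr EFin.
rewrite /gap /y !ln_div ?posrE//; field.
by rewrite gt_eqF.
Qed.

Lemma integral_envelope_le : (\int[P]_z (envelope p (y z))%:E <=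
  (A^-1 `^ (p - 1) * (3 + 2 * ln A ^+ 2) * J)%:E)%E.
Proof.
rewrite (ge0_integral_density fP); last 2 first.
- exact: measurable_envelope.
- by move=> z; exact: envelope_ge0.
set a := A^-1 `^ (p - 1); set b := 2 * (1 + ln A ^+ 2).
have a0 : 0 <= a := powR_ge0 _ _.
have b0 : 0 <= b by rewrite mulr_ge0// addr_ge0// sqr_ge0.
have mfmp : measurable_fun setT (fun z => (fm z `^ p)%:E).
  by apply/measurable_EFinP/measurable_powRl.
have mwE : measurable_fun setT (fun z => (w z)%:E) by apply/measurable_EFinP.
apply: (@le_trans _ _ (\int[mu]_z (a%:E * ((fm z `^ p)%:E + b%:E * (w z)%:E)))%E).
  apply: ge0_le_integral => //.
  - by move=> z _; rewrite lee_fin mulr_ge0 ?envelope_ge0// ltW.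
  - apply/measurable_EFinP/measurable_funM => //; exact: measurable_envelope.
  - apply: measurable_funeM; apply: emeasurable_funD => //.
    exact: measurable_funeM.
  - by move=> z _; rewrite -EFinM lee_fin mul_envelope_le.
rewrite ge0_integralZl_EFin//; last 2 first.
- move=> z _; rewrite -EFinM lee_fin.
  exact: addr_ge0 (powR_ge0 _ _) (mulr_ge0 b0 (w_ge0 z)).
- by apply: emeasurable_funD => //; exact: measurable_funeM.
rewrite ge0_integralD//; last 3 first.
- by move=> z _; rewrite lee_fin powR_ge0.
- by move=> z _; rewrite -EFinM lee_fin mulr_ge0.
- exact: measurable_funeM.
rewrite ge0_integralZl_EFin//; last by move=> z _; rewrite lee_fin.
have fmJ : (\int[mu]_z (fm z `^ p)%:E <= J%:E)%E.
  apply: (le_trans (integral_powR_histogram_proj_le fP A0 Af HL p1)).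
  rewrite -HJ; apply: ge0_le_integral => //.
  - by move=> z _; rewrite lee_fin powR_ge0.
  - by apply/measurable_EFinP/measurable_powRl.
  - move=> z _; rewrite lee_fin ler_peMr ?powR_ge0//.
    by rewrite le_max lexx orbT.
rewrite [X in (_ * (_ + _ * X))%E]HJ.
apply: (@le_trans _ _ (a%:E * (J%:E + b%:E * J%:E))%E).
  by rewrite lee_wpmul2l// leeD2r.
by rewrite -EFinM lee_fin /b; lra.
Qed.

Lemma integral_le_powR_KL (T : Z -> R) (C s : R) : 0 < s <= 1 -> 0 <= C ->
  measurable_fun setT T -> (forall z, 0 <= T z) ->
  (forall z, T z <= C * (gap (y z) `^ (1 - s) * envelope p (y z) `^ s)) ->
  (\int[P]_z (T z)%:E <=
    (C * (A^-1 `^ (p - 1) * (3 + 2 * ln A ^+ 2) * J) `^ s)%:E *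
    KL mu f fm `^ (1 - s))%E.
Proof.
move=> /andP[s0 s1] C0 mT T0 TC.
have mg : measurable_fun setT (fun z => gap (y z)) by exact: measurable_gap.
have me : measurable_fun setT (fun z => envelope p (y z)).
  exact: measurable_envelope.
have mge : measurable_fun setT
    (fun z => (gap (y z) `^ (1 - s) * envelope p (y z) `^ s)%:E).
  by apply/measurable_EFinP/measurable_funM; exact: measurable_powRl.
apply: (@le_trans _ _ (\int[P]_z (C%:E *
    (gap (y z) `^ (1 - s) * envelope p (y z) `^ s)%:E))%E).
  apply: ge0_le_integral => //.
  - by move=> z _; rewrite lee_fin.
  - exact/measurable_EFinP.
  - exact: measurable_funeM.
  - by move=> z _; rewrite -EFinM lee_fin.
rewrite ge0_integralZl_EFin//; last first.
  by move=> z _; rewrite lee_fin mulr_ge0 ?powR_ge0.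
rewrite EFinM -muleA lee_wpmul2l//.
have s01 : 0 < s <= 1 by rewrite s0.
have := @integral_geomean_le _ _ _ P _ _ _ s01 mg me
  (fun z => gap_ge0 (y_gt0 z)) (fun z => envelope_ge0 _ _).
rewrite -KL_eq_integral_gap => /le_trans; apply.
rewrite muleC; apply: lee_wpmul2r; first exact: poweR_ge0.
rewrite -poweR_EFin; apply: gt0_ler_poweR; rewrite ?(ltW s0)//.
- rewrite in_itv/= leey andbT; apply: integral_ge0 => z _.
  by rewrite lee_fin envelope_ge0.
- rewrite in_itv/= leey andbT; apply: le_trans integral_envelope_le.
  by apply: integral_ge0 => z _; rewrite lee_fin envelope_ge0.
- exact: integral_envelope_le.
Qed.

End Divergence.

(** * The main bounds *)

Lemma ae_le_Lnorm_infty (d : measure_display) (Z : measurableType d) (R : realType)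
    (mu : probability Z R) (f : Z -> R) (B : R) :
  ('N[mu]_+oo[EFin \o f] = B%:E)%E -> {ae mu, forall z, f z <= B}.
Proof.
rewrite unlock /Lnorm [X in (0 < X)%E]probability_setT lte01 => NB.
have /ess_supP : (ess_sup mu (abse \o (EFin \o f)) <= B%:E)%E by rewrite NB.
by apply: filterS => z /=; rewrite lee_fin; apply: le_trans; exact: ler_norm.
Qed.

Theorem proposition4p7 (R : realType) :
  (forall p Amin J r : R, 1 < p -> 0 < Amin -> 0 < r -> r <= p - 1 ->
    exists2 A_MR : R, 0 < A_MR &
    forall (d : measure_display) (Z : measurableType d)
      (mu P : probability Z R) (f : Z -> R)
      (M : set (set (Z -> R))) (Lambda : set (Z -> R) -> set (set Z))
      (cplus cminus : R),
      0 < cplus -> 0 < cminus ->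
      is_density mu P f ->
      P.-integrable setT (EFin \o (fun z => ln (f z))) ->
      histogram_collection mu M Lambda ->
      (\int[mu]_z (f z `^ p * Num.max (ln (f z) ^+ 2) 1)%:E)%E = J%:E ->
      (Amin%:E <= ereal_inf (range (EFin \o f)))%E ->
      forall m, M m ->
        let fm := histogram_proj mu P (Lambda m) in
        (\int[P]_z (Num.max (fm z / f z) 1 * ln (fm z / f z) ^+ 2)%:E
           <= A_MR%:E * KL mu f fm `^ (1 - 1 / p))%E
        /\
        (\int[P]_z (Num.max (f z / fm z) 1 `^ r * ln (fm z / f z) ^+ 2)%:E
           <= A_MR%:E * KL mu f fm `^ (1 - (r + 1) / p))%E)
  /\
  (forall r Amin B : R, 0 < r -> 0 < Amin ->
    exists2 Atilde : R, 0 < Atilde &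
    forall (d : measure_display) (Z : measurableType d)
      (mu P : probability Z R) (f : Z -> R)
      (M : set (set (Z -> R))) (Lambda : set (Z -> R) -> set (set Z))
      (p J cplus cminus : R),
      1 < p -> r <= p - 1 -> 0 < cplus -> 0 < cminus ->
      is_density mu P f ->
      P.-integrable setT (EFin \o (fun z => ln (f z))) ->
      histogram_collection mu M Lambda ->
      (\int[mu]_z (f z `^ p * Num.max (ln (f z) ^+ 2) 1)%:E)%E = J%:E ->
      (Amin%:E <= ereal_inf (range (EFin \o f)))%E ->
      ('N[mu]_+oo[EFin \o f] = B%:E)%E ->
      forall m, M m ->
        let fm := histogram_proj mu P (Lambda m) in
        (Order.max
           (\int[P]_z (Num.max (fm z / f z) 1 * ln (fm z / f z) ^+ 2)%:E)
           (\int[P]_z (Num.max (f z / fm z) 1 `^ r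
                       * ln (fm z / f z) ^+ 2)%:E)
           <= Atilde%:E * KL mu f fm)%E).
Proof.
have mT (d : measure_display) (Z : measurableType d) (y : Z -> R) (a : R) :
    measurable_fun setT y ->
    measurable_fun setT (fun z => Num.max (y z) 1 * ln (y z) ^+ 2) /\
    measurable_fun setT (fun z => Num.max (y z)^-1 1 `^ a * ln (y z) ^+ 2).
  move=> my; have ml : measurable_fun setT (fun z => ln (y z) ^+ 2).
    exact/measurable_funX/measurable_lnr.
  split; apply: measurable_funM => //.
    exact: measurable_maxr.
  apply/measurable_powRl/measurable_maxr => //; exact: measurable_invr.
have max_ln_ge0 (u l : R) : 0 <= Num.max u 1 * l ^+ 2.
  by rewrite mulr_ge0 ?sqr_ge0// le_max ler01 orbT.
have powR_ln_ge0 (u l a : R) : 0 <= Num.max u 1 `^ a * l ^+ 2.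
  by rewrite mulr_ge0 ?sqr_ge0 ?powR_ge0.
split=> [p A J r p1 A0 r0 rp|r A B r0 A0].
  have [C C0 TC] := max_ln_sqr_le p1.
  have p0 : 0 < p := lt_trans ltr01 p1.
  have rp1 : r + 1 <= p by rewrite -lerBrDr.
  set D := A^-1 `^ (p - 1) * (3 + 2 * ln A ^+ 2) * J.
  have D1 : 0 <= C * D `^ (1 / p) by rewrite mulr_ge0 ?powR_ge0// ltW.
  have D2 : 0 <= 4 * D `^ ((r + 1) / p) by rewrite mulr_ge0 ?powR_ge0.
  (* J is an arbitrary real number at this point; the powers are nonnegative
     for every D, and adding 1 makes the constant positive. *)
  exists (C * D `^ (1 / p) + 4 * D `^ ((r + 1) / p) + 1); first lra.
  move=> d Z mu P f M Lambda _ _ _ _ fP _ [_ HM] HJ HA m Mm fm.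
  have [HL _] := HM _ Mm.
  have Af z : A <= f z.
    by rewrite -lee_fin (le_trans HA)//; apply: ereal_inf_lbound; exists z.
  have f0 z : 0 < f z := lt_le_trans A0 (Af z).
  have fm0 z : 0 < fm z.
    exact: lt_le_trans (histogram_proj_ge fP A0 Af HL z).
  have y0 z : 0 < fm z / f z by rewrite divr_gt0.
  have my : measurable_fun setT (fun z => fm z / f z).
    apply: measurable_funM; first exact: (measurable_histogram_proj P HL).
    by apply: measurable_invr; case: fP.
  have [mT1 mT2] := mT _ _ _ r my.
  have main := integral_le_powR_KL fP A0 Af HL p1 HJ.
  split.
    apply: (le_trans (main _ C (1 / p) _ (ltW C0) mT1 _ _)) => //.
    - by rewrite divr_gt0//= ler_pdivrMr// mul1r ltW.
    - by move=> z; exact: TC.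
    - apply: lee_wpmul2r; first exact: poweR_ge0.
      by rewrite lee_fin -/D; lra.
  under eq_integral do rewrite -invf_div.
  apply: (le_trans (main _ 4 ((r + 1) / p) _ _ mT2 _ _)) => //.
  - by rewrite divr_gt0//= ?ler_pdivrMr// ?mul1r// addr_gt0.
  - by move=> z; apply: max_powR_ln_sqr_le => //; exact: ltW.
  - apply: lee_wpmul2r; first exact: poweR_ge0.
    by rewrite lee_fin -/D; lra.
(* The maximum with 1 covers all B: B >= A is known only once f is given. *)
pose K := Num.max (B / A) 1.
have K1 : 1 <= K by rewrite le_max lexx orbT.
have BK : B / A <= K by rewrite le_max lexx.
have K0 : 0 < K by lra.
exists (4 * K `^ (r + 1)); first by rewrite mulr_gt0// powR_gt0.
move=> d Z mu P f M Lambda p J _ _ p1 rp _ _ fP _ [_ HM] HJ HA NB m Mm /=.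
set fm := histogram_proj mu P (Lambda m).
have [HL _] := HM _ Mm.
have Af z : A <= f z.
  by rewrite -lee_fin (le_trans HA)//; apply: ereal_inf_lbound; exists z.
have f0 z : 0 < f z := lt_le_trans A0 (Af z).
have fm_ge z : A <= fm z := histogram_proj_ge fP A0 Af HL z.
have fm0 z : 0 < fm z := lt_le_trans A0 (fm_ge z).
have y0 z : 0 < fm z / f z by rewrite divr_gt0.
have my : measurable_fun setT (fun z => fm z / f z).
  apply: measurable_funM; first exact: (measurable_histogram_proj P HL).
  by apply: measurable_invr; case: fP.
have [mT1 mT2] := mT _ _ _ r my.
have fB := ae_le_Lnorm_infty NB.
have fmB := histogram_proj_le fP HL fB.
have ratio_le u v : 0 < u -> u <= B -> A <= v -> u / v <= K.
  move=> u0 uB Av; apply: le_trans BK.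
  have v0 : 0 < v by lra.
  by rewrite ler_pM ?invr_ge0 ?(ltW u0) ?(ltW v0)// lef_pV2.
have fBP : {ae P, forall z, f z <= B}.
  have [N [mN N0 sN]] := fB; exists N; split=> //.
  exact: ((null_content_dominatesP _ _).1 (density_dominates fP)).
have main (T : Z -> R) : measurable_fun setT T -> (forall z, 0 <= T z) ->
    (forall z, f z <= B -> T z <= 4 * K `^ (r + 1) * gap (fm z / f z)) ->
    (\int[P]_z (T z)%:E <= (4 * K `^ (r + 1))%:E * KL mu f fm)%E.
  move=> mT' T0 TK.
  rewrite (KL_eq_integral_gap fP A0 Af HL p1 HJ).
  have mg := measurable_gap my.
  rewrite -ge0_integralZl_EFin//; last 3 first.
  - by move=> z _; rewrite lee_fin gap_ge0.
  - exact/measurable_EFinP.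
  - by rewrite mulr_ge0// powR_ge0.
  apply: ae_ge0_le_integral => //.
  - by move=> z _; rewrite lee_fin.
  - exact/measurable_EFinP.
  - by move=> z _; rewrite -EFinM lee_fin !mulr_ge0 ?powR_ge0 ?gap_ge0.
  - by apply: measurable_funeM; exact/measurable_EFinP.
  by apply: filterS fBP => z /TK h _; rewrite -EFinM lee_fin.
have KK : K <= K `^ (r + 1) by rewrite le1r_powR//; lra.
rewrite ge_max; apply/andP; split.
  apply: main => // z fzB.
  apply: (le_trans (max_ln_sqr_le_bounded K1 (y0 z) _ _)).
  - exact: ratio_le.
  - by rewrite invf_div ratio_le.
  - by rewrite ler_wpM2r ?gap_ge0// ler_pM2l.
under eq_integral do rewrite -invf_div.
apply: main => // z fzB.
by apply: max_powR_ln_sqr_le_bounded; rewrite ?invf_div ?ratio_le// ltW.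
Qed.
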